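(* Let $\beta: I\to M\subset G^3$ be a unit-speed curve on a surface $M$ in the Galilean space $G^3$, with curvature $\kappa>0$ and torsion $\tau$, which is a line of curvature ($\tau_g\equiv0$), with geodesic curvature $\kappa_g$ and normal curvature $\kappa_n$. Then $\beta$ is a generalized helix ($\tau/\kappa$ is constant) if and only if, on $I$, $$\kappa_g''\kappa_n^3+\kappa_g''\kappa_n\kappa_g^2-\kappa_n^2\kappa_g\kappa_n''-3\kappa_n^2\kappa_g'\kappa_n'-3\kappa_n\kappa_g(\kappa_g')^2+3\kappa_n\kappa_g(\kappa_n')^2-\kappa_g^3\kappa_n''+3\kappa_g^2\kappa_g'\kappa_n'=0.$$
   Context: The Galilean space $G^3$ is $\mathbb R^3$ with the scalar product $\mathbf v\cdot_G\mathbf w=v_1w_1$ if $v_1\ne0$ or $w_1\neq 0$, and $\mathbf v\cdot_G\mathbf w=v_2w_2+v_3w_3$ if $v_1=w_1=0$; the norm is $\|\mathbf v\|_G=\sqrt{|\mathbf v\cdot_G\mathbf v|}$ and the cross product is $\mathbf v\times_G\mathbf w=(0,\,v_3w_1-v_1w_3,\,v_1w_2-v_2w_1)$. A vector is isotropic if its first component is $0$. All objects are smooth and $I\subset\mathbb R$ is an open interval. $M$ is an oriented surface with local parametrizations $\phi(u,v)$ such that the first components of $\phi_u,\phi_v$ are not both zero; its unit normal is the isotropic vector field $\mathbf n=\pm\,\phi_u\times_G\phi_v/\|\phi_u\times_G\phi_v\|_G$ (sign fixed by the orientation). A unit-speed curve (parametrized by arc length) is one of the form $\beta(x)=(x,y(x),z(x))$,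 $x\in I$. Its curvature is $\kappa=\|\beta''\|_G$ and its torsion is $\tau=\det(\beta',\beta'',\beta''')/\kappa^2$. Its Darboux frame with respect to $M$ is $\{\mathbf T,\mathbf Q,\mathbf n\}$ with $\mathbf T=\beta'$, $\mathbf n$ the unit normal of $M$ along $\beta$, and $\mathbf Q=\mathbf T\times_G\mathbf n$. The functions $\kappa_g=\mathbf T'\cdot_G\mathbf Q$, $\kappa_n=\mathbf T'\cdot_G\mathbf n$, $\tau_g=\mathbf Q'\cdot_G\mathbf n$ are the geodesic curvature, normal curvature and geodesic torsion. *)

(* Defs.v *)
From Stdlib Require Import Reals.
From Coquelicot Require Import Coquelicot.
Open Scope R_scope.

Notation vec3 := (R * R * R)%type.

Definition coord1 (v : vec3) : R := fst (fst v).
Definition coord2 (v : vec3) : R := snd (fst v).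
Definition coord3 (v : vec3) : R := snd v.

Definition dotG (v w : vec3) : R :=
  if Req_EM_T (coord1 v) 0 then
    if Req_EM_T (coord1 w) 0 then coord2 v * coord2 w + coord3 v * coord3 w
    else coord1 v * coord1 w
  else coord1 v * coord1 w.

Definition normG (v : vec3) : R := sqrt (Rabs (dotG v v)).

Definition crossG (v w : vec3) : vec3 :=
  (0, coord3 v * coord1 w - coord1 v * coord3 w, coord1 v * coord2 w - coord2 v * coord1 w).

Definition det3 (u v w : vec3) : R :=
  coord1 u * (coord2 v * coord3 w - coord3 v * coord2 w)
  - coord2 u * (coord1 v * coord3 w - coord3 v * coord1 w)
  + coord3 u * (coord1 v * coord2 w - coord2 v * coord1 w).

(* [Derive] is total, so these derivatives are meaningful only where the
   function is differentiable; all uses below are on open sets where it is. *)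
Definition derive3 (f : R -> vec3) (x : R) : vec3 :=
  (Derive (fun t => coord1 (f t)) x,
   Derive (fun t => coord2 (f t)) x,
   Derive (fun t => coord3 (f t)) x).

Definition Rbar_interval (a b : Rbar) (x : R) : Prop :=
  Rbar_lt a x /\ Rbar_lt x b.

Definition smooth_on (I : R -> Prop) (f : R -> R) : Prop :=
  forall (n : nat) (x : R), I x -> ex_derive_n f n x.

Definition smooth3_on (I : R -> Prop) (f : R -> vec3) : Prop :=
  smooth_on I (fun x => coord1 (f x)) /\
  smooth_on I (fun x => coord2 (f x)) /\
  smooth_on I (fun x => coord3 (f x)).

Definition partial_u (f : R -> R -> R) (u v : R) : R :=
  Derive (fun s => f s v) u.
Definition partial_v (f : R -> R -> R) (u v : R) : R :=
  Derive (fun t => f u t) v.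

(* Class C^k on an open subset [U] of the plane. *)
Fixpoint Ck_on (k : nat) (U : R * R -> Prop) (f : R -> R -> R) : Prop :=
  (forall u v, U (u, v) -> continuity_2d_pt f u v) /\
  match k with
  | O => True
  | S k' =>
      (forall u v, U (u, v) ->
         ex_derive (fun s => f s v) u /\ ex_derive (fun t => f u t) v) /\
      Ck_on k' U (partial_u f) /\ Ck_on k' U (partial_v f)
  end.

Definition smooth3_on2 (U : R * R -> Prop) (phi : R -> R -> vec3) : Prop :=
  forall k : nat,
    Ck_on k U (fun u v => coord1 (phi u v)) /\
    Ck_on k U (fun u v => coord2 (phi u v)) /\
    Ck_on k U (fun u v => coord3 (phi u v)).

Definition phi_u (phi : R -> R -> vec3) (u v : R) : vec3 :=
  derive3 (fun s => phi s v) u.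
Definition phi_v (phi : R -> R -> vec3) (u v : R) : vec3 :=
  derive3 (fun t => phi u t) v.

Definition linearly_independent (v w : vec3) : Prop :=
  forall a b : R, plus (scal a v) (scal b w) = zero -> a = 0 /\ b = 0.

(* [phi] maps the open set [U] of the plane homeomorphically onto the
   relatively open part [M] /\ [W] of [M], and is a smooth immersion with the
   Galilean admissibility condition on the first components of its partial
   derivatives; [psi] is the inverse homeomorphism. *)
Definition local_parametrization (M : vec3 -> Prop) (U : R * R -> Prop)
    (W : vec3 -> Prop) (phi : R -> R -> vec3) : Prop :=
  open U /\ open W /\ smooth3_on2 U phi /\
  (forall u v, U (u, v) -> linearly_independent (phi_u phi u v) (phi_v phi u v)) /\
  (forall u v, U (u, v) ->
     coord1 (phi_u phi u v) <> 0 \/ coord1 (phi_v phi u v) <> 0) /\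
  exists psi : vec3 -> R * R,
    (forall u v, U (u, v) ->
       M (phi u v) /\ W (phi u v) /\ psi (phi u v) = (u, v)) /\
    (forall p, M p -> W p ->
       U (psi p) /\ phi (fst (psi p)) (snd (psi p)) = p) /\
    (forall p, M p -> W p ->
       filterlim psi (within M (locally p)) (locally (psi p))).

Definition param_normal (phi : R -> R -> vec3) (u v : R) : vec3 :=
  let w := crossG (phi_u phi u v) (phi_v phi u v) in scal (/ normG w) w.

(* The orientation is carried by the unit normal field: around every point
   there is a local parametrization on which the sign in
   n = +- phi_u x phi_v / |phi_u x phi_v| does not change. *)
Record oriented_surface : Type := {
  carrier : vec3 -> Prop;
  unit_normal : vec3 -> vec3;
  surface_charts : forall p, carrier p ->
    exists (U : R * R -> Prop) (W : vec3 -> Prop) (phi : R -> R -> vec3) (s : R),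
      local_parametrization carrier U W phi /\ W p /\
      (s = 1 \/ s = -1) /\
      (forall u v, U (u, v) ->
         unit_normal (phi u v) = scal s (param_normal phi u v))
}.

Definition unit_speed_curve (I : R -> Prop) (beta : R -> vec3) : Prop :=
  smooth3_on I beta /\ forall x, I x -> coord1 (beta x) = x.

Definition curvature (beta : R -> vec3) (x : R) : R :=
  normG (derive3 (derive3 beta) x).

Definition torsion (beta : R -> vec3) (x : R) : R :=
  det3 (derive3 beta x) (derive3 (derive3 beta) x)
       (derive3 (derive3 (derive3 beta)) x) / curvature beta x ^ 2.

Definition darboux_T (beta : R -> vec3) : R -> vec3 := derive3 beta.

Definition darboux_n (M : oriented_surface) (beta : R -> vec3) (x : R) : vec3 :=
  unit_normal M (beta x).

Definition darboux_Q (M : oriented_surface) (beta : R -> vec3) (x : R) : vec3 :=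
  crossG (darboux_T beta x) (darboux_n M beta x).

Definition geodesic_curvature (M : oriented_surface) (beta : R -> vec3) (x : R) : R :=
  dotG (derive3 (darboux_T beta) x) (darboux_Q M beta x).

Definition normal_curvature (M : oriented_surface) (beta : R -> vec3) (x : R) : R :=
  dotG (derive3 (darboux_T beta) x) (darboux_n M beta x).

Definition geodesic_torsion (M : oriented_surface) (beta : R -> vec3) (x : R) : R :=
  dotG (derive3 (darboux_Q M beta) x) (darboux_n M beta x).

Definition line_of_curvature (I : R -> Prop) (M : oriented_surface)
    (beta : R -> vec3) : Prop :=
  forall x, I x -> geodesic_torsion M beta x = 0.

Definition generalized_helix (I : R -> Prop) (beta : R -> vec3) : Prop :=
  exists c : R, forall x, I x -> torsion beta x / curvature beta x = c.

(* Main.v *)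
Require Import Defs.
From Stdlib Require Import Reals Lra.
From Coquelicot Require Import Coquelicot.
Open Scope R_scope.

(** Along a unit-speed curve the unit normal is an isotropic Euclidean unit
    vector (0, n2, n3), so Q = (0, -n3, n2), and tau_g = 0 forces n' = 0: the
    normal is constant. Hence kg and kn are y'' and z'' seen in a fixed rotated
    frame, kappa^2 = kg^2 + kn^2, and
      tau / kappa = (kn kg' - kg kn') / (kg^2 + kn^2)^(3/2).
    The equation of the theorem is the vanishing of the derivative of this
    quotient, cleared of denominators. The delicate point is that n is
    differentiable along the curve: the curve is only known to be continuous in
    the coordinates of a chart, and its differentiability there is obtained by
    inverting, with Cramer's rule, the first-order expansion of the chart. *)

(** * First-order expansions and the inversion of a planar map along a curve *)

(** Gives the derivative as an explicit remainder estimate, the form that can be added to and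
    subtracted from the two-variable expansion of a chart. *)
Lemma is_derive_little_o (f : R -> R) (x l : R) :
  is_derive f x l <->
  forall eps : posreal,
    locally x (fun t => Rabs (f t - f x - l * (t - x)) <= eps * Rabs (t - x)).
Proof.
  split.
  - intros [_ H] eps.
    generalize (H x (fun P HP => HP) eps); apply filter_imp; intros t Ht.
    replace (f t - f x - l * (t - x))
      with (f t + - f x + - ((t + - x) * l)); [exact Ht | ring].
  - intros H; split; [apply is_linear_scal_l |].
    intros y Hy eps.
    assert (y = x) as -> by
      (symmetry; exact (is_filter_lim_locally_unique x y Hy)).
    generalize (H eps); apply filter_imp; intros t Ht.
    replace (f t - f x - l * (t - x))
      with (f t + - f x + - ((t + - x) * l)) in Ht; [exact Ht | ring].
Qed.

(** Cramer's rule as an estimate: [D * U] and [D * V] are combinations of the two rows with matrix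
    entries as coefficients, so the sum of all absolute entries serves for both unknowns. *)
Lemma cramer_bound (a b c d U V A B : R) :
  Rabs (a * U + b * V) <= A -> Rabs (c * U + d * V) <= B ->
  Rabs (a * d - b * c) * Rmax (Rabs U) (Rabs V) <=
  (Rabs a + Rabs b + Rabs c + Rabs d) * (A + B).
Proof.
  intros HA HB.
  assert (0 <= A) by (eapply Rle_trans; [apply Rabs_pos | exact HA]).
  assert (0 <= B) by (eapply Rle_trans; [apply Rabs_pos | exact HB]).
  assert (Hcomb : forall r s, Rabs (r * (a * U + b * V) - s * (c * U + d * V))
            <= Rabs r * A + Rabs s * B).
  { intros r s. eapply Rle_trans; [apply Rabs_triang |].
    rewrite Rabs_Ropp, !Rabs_mult.
    apply Rplus_le_compat; apply Rmult_le_compat_l; auto using Rabs_pos. }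
  pose proof (Rabs_pos a); pose proof (Rabs_pos b);
  pose proof (Rabs_pos c); pose proof (Rabs_pos d).
  apply Rmax_case; rewrite <- Rabs_mult.
  - replace ((a * d - b * c) * U)
      with (d * (a * U + b * V) - b * (c * U + d * V)) by ring.
    eapply Rle_trans; [apply Hcomb | nra].
  - replace ((a * d - b * c) * V)
      with (- (c * (a * U + b * V) - a * (c * U + d * V))) by ring.
    rewrite Rabs_Ropp. eapply Rle_trans; [apply Hcomb | nra].
Qed.

(** Continuity of [u] and [v] is enough to pull the expansion of [f] back to the parameter; the
    remainder is still measured by the increments of [u] and [v], not by [t - x]. *)
Lemma differentiable_pt_lim_curve (f : R -> R -> R) (u v : R -> R) (x a b : R) :
  differentiable_pt_lim f (u x) (v x) a b ->
  continuous u x -> continuous v x ->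
  forall eps : posreal, locally x (fun t =>
    Rabs (f (u t) (v t) - f (u x) (v x) - (a * (u t - u x) + b * (v t - v x)))
    <= eps * Rmax (Rabs (u t - u x)) (Rabs (v t - v x))).
Proof.
  intros Hf Hu Hv eps. destruct (Hf eps) as [delta Hd].
  assert (H1 := proj1 (filterlim_locally u (u x)) Hu delta).
  assert (H2 := proj1 (filterlim_locally v (v x)) Hv delta).
  generalize (filter_and _ _ H1 H2); apply filter_imp.
  intros t [Ht1 Ht2]. exact (Hd _ _ Ht1 Ht2).
Qed.

(** Two passes of Cramer's rule. The first yields only a Lipschitz bound on the increments of [u]
    and [v]. With it the chart remainders become small relative to [t - x], and the second pass
    identifies the derivatives as the solution of the linear system with right-hand side
    [(p, q)]. *)
Lemma inverse_curve_derivable (f g : R -> R -> R) (u v : R -> R)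
    (x a b c d p q : R) :
  differentiable_pt_lim f (u x) (v x) a b ->
  differentiable_pt_lim g (u x) (v x) c d ->
  a * d - b * c <> 0 ->
  continuous u x -> continuous v x ->
  is_derive (fun t => f (u t) (v t)) x p ->
  is_derive (fun t => g (u t) (v t)) x q ->
  ex_derive u x /\ ex_derive v x.
Proof.
  intros Hf Hg HD Hu Hv Hp Hq.
  pose (D := Rabs (a * d - b * c)).
  pose (S := Rabs a + Rabs b + Rabs c + Rabs d).
  pose (m := fun t => Rmax (Rabs (u t - u x)) (Rabs (v t - v x))).
  assert (D0 : 0 < D) by (apply Rabs_pos_lt, HD).
  assert (S0 : 0 <= S).
  { unfold S. pose proof (Rabs_pos a); pose proof (Rabs_pos b);
    pose proof (Rabs_pos c); pose proof (Rabs_pos d); lra. }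
  assert (Hf' := differentiable_pt_lim_curve f u v x a b Hf Hu Hv).
  assert (Hg' := differentiable_pt_lim_curve g u v x c d Hg Hu Hv).
  assert (Hp' := proj1 (is_derive_little_o _ _ _) Hp).
  assert (Hq' := proj1 (is_derive_little_o _ _ _) Hq).
  assert (Hlip : exists C, 0 <= C /\ locally x (fun t => m t <= C * Rabs (t - x))).
  (* The two remainders contribute at most [2 * S * eta * m t], which is at most [D / 2 * m t] for
     this [eta]; it is absorbed into [D * m t], and the factor 2 in the Lipschitz constant comes
     from there. [S + 1] keeps the denominator positive. *)
  { assert (eta0 : 0 < D / (4 * (S + 1))) by (apply Rdiv_lt_0_compat; lra).
    pose (eta := mkposreal _ eta0).
    exists (2 * S * (Rabs p + Rabs q + 2) / D). split.
    { apply Rle_mult_inv_pos; auto. pose proof (Rabs_pos p); pose proof (Rabs_pos q); nra. }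
    pose (one := mkposreal 1 Rlt_0_1).
    generalize (filter_and _ _ (filter_and _ _ (Hf' eta) (Hg' eta))
                  (filter_and _ _ (Hp' one) (Hq' one))).
    apply filter_imp. intros t [[F G] [P Q]]. fold (m t) in F, G.
    cbn in F, G, P, Q.
    assert (Hc := cramer_bound a b c d (u t - u x) (v t - v x)
      ((Rabs p + 1) * Rabs (t - x) + D / (4 * (S + 1)) * m t)
      ((Rabs q + 1) * Rabs (t - x) + D / (4 * (S + 1)) * m t)).
    fold (m t) D S in Hc.
    (* Here [X] is the increment of [f] or [g] along the curve, [L] its linear part in the
       increments of [u] and [v], and [r * h] its linear part in [t - x]. *)
    assert (tri : forall X L r h n, Rabs (X - L) <= n ->
              Rabs (X - r * h) <= 1 * Rabs h -> Rabs L <= (Rabs r + 1) * Rabs h + n).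
    { intros X L r h n H1 H2.
      replace L with ((X - r * h) + (r * h) - (X - L)) by ring.
      eapply Rle_trans; [apply Rabs_triang |]. rewrite Rabs_Ropp.
      apply Rplus_le_compat; auto.
      eapply Rle_trans; [apply Rabs_triang |]. rewrite (Rabs_mult r h). lra. }
    specialize (Hc (tri _ _ _ _ _ F P) (tri _ _ _ _ _ G Q)).
    assert (m0 : 0 <= m t) by (eapply Rle_trans; [apply Rabs_pos | apply Rmax_l]).
    assert (HS : S * (D / (4 * (S + 1))) <= D / 4).
    { replace (S * (D / (4 * (S + 1)))) with (D / 4 - D / (4 * (S + 1))) by (field; lra).
      lra. }
    apply Rmult_le_reg_l with D; auto.
    replace (D * (2 * S * (Rabs p + Rabs q + 2) / D * Rabs (t - x)))
      with (2 * S * (Rabs p + Rabs q + 2) * Rabs (t - x)) by (field; lra).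
    assert (S * (D / (4 * (S + 1))) * m t <= D / 4 * m t)
      by (apply Rmult_le_compat_r; auto).
    lra. }
  destruct Hlip as [C [C0 HC]].
  assert (Hmain : forall eps : posreal, locally x (fun t =>
    Rmax (Rabs (u t - u x - (d * p - b * q) / (a * d - b * c) * (t - x)))
         (Rabs (v t - v x - (a * q - c * p) / (a * d - b * c) * (t - x)))
    <= eps * Rabs (t - x))).
  { intros eps.
    (* Both rows are bounded by [eta * (1 + C) * Rabs (t - x)], so Cramer's rule produces
       [2 * S * eta * (1 + C)], which this choice makes at most [D * eps]. *)
    assert (eta0 : 0 < eps * D / (2 * (S + 1) * (1 + C))).
    { apply Rdiv_lt_0_compat; [apply Rmult_lt_0_compat; auto; apply cond_pos | nra]. }
    pose (eta := mkposreal _ eta0).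
    generalize (filter_and _ _ HC (filter_and _ _ (filter_and _ _ (Hf' eta) (Hg' eta))
                  (filter_and _ _ (Hp' eta) (Hq' eta)))).
    apply filter_imp. intros t [Hm [[F G] [P Q]]]. fold (m t) in F, G.
    assert (He : eta = eps * D / (2 * (S + 1) * (1 + C)) :> R) by reflexivity.
    pose proof (cond_pos eta) as e0.
    assert (tri : forall X L r h, Rabs (X - L) <= eta * m t ->
              Rabs (X - r * h) <= eta * Rabs h -> Rabs (L - r * h) <= eta * Rabs h + eta * m t).
    { intros X L r h H1 H2.
      replace (L - r * h) with ((X - r * h) - (X - L)) by ring.
      eapply Rle_trans; [apply Rabs_triang |]. rewrite Rabs_Ropp. lra. }
    assert (HB : forall L, Rabs L <= eta * Rabs (t - x) + eta * m t ->
              Rabs L <= eta * (1 + C) * Rabs (t - x)).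
    { intros L HL. eapply Rle_trans; [exact HL |].
      assert (eta * m t <= eta * (C * Rabs (t - x))) by (apply Rmult_le_compat_l; lra).
      lra. }
    (* The unknowns are now the deviations from the candidate tangent increments; since the
       candidates solve the system, the rows become [L - p * (t - x)] and [L - q * (t - x)] with the
       respective linear parts [L]. *)
    assert (Hc := cramer_bound a b c d
      (u t - u x - (d * p - b * q) / (a * d - b * c) * (t - x))
      (v t - v x - (a * q - c * p) / (a * d - b * c) * (t - x))
      (eta * (1 + C) * Rabs (t - x)) (eta * (1 + C) * Rabs (t - x))).
    fold D S in Hc.
    apply Rmult_le_reg_l with D; auto.
    eapply Rle_trans; [apply Hc |].
    - apply HB. eapply Rle_trans; [| exact (tri _ _ _ _ F P)].
      right; f_equal; field; auto.
    - apply HB. eapply Rle_trans; [| exact (tri _ _ _ _ G Q)].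
      right; f_equal; field; auto.
    - rewrite He.
      replace (S * (eps * D / (2 * (S + 1) * (1 + C)) * (1 + C) * Rabs (t - x) +
                    eps * D / (2 * (S + 1) * (1 + C)) * (1 + C) * Rabs (t - x)))
        with (S * / (S + 1) * (D * (eps * Rabs (t - x)))) by (field; lra).
      rewrite <- (Rmult_1_l (D * _)) at 2.
      apply Rmult_le_compat_r.
      + apply Rmult_le_pos; [lra |].
        apply Rmult_le_pos; [left; apply cond_pos | apply Rabs_pos].
      + apply Rmult_le_reg_r with (S + 1); [lra |].
        rewrite Rmult_assoc, Rinv_l; lra. }
  split; [exists ((d * p - b * q) / (a * d - b * c))
         | exists ((a * q - c * p) / (a * d - b * c))];
    apply is_derive_little_o; intros eps; generalize (Hmain eps);
    apply filter_imp; intros t Ht; eapply Rle_trans; try exact Ht;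
    [apply Rmax_l | apply Rmax_r].
Qed.

(** * Total differentiability of smooth functions of two variables and the chain rule *)

Lemma C1_differentiable (U : R * R -> Prop) (f : R -> R -> R) (u v : R) :
  open U -> Ck_on 1 U f -> U (u, v) ->
  differentiable_pt_lim f u v (partial_u f u v) (partial_v f u v).
Proof.
  intros HU (_ & Hd & [Hcu _] & _) Huv.
  apply filterdiff_differentiable_pt_lim.
  apply (is_derive_filterdiff f u v (partial_u f) (partial_v f u v)).
  - generalize (HU _ Huv); apply filter_imp; intros [r s] Hrs.
    apply Derive_correct, (proj1 (Hd r s Hrs)).
  - apply Derive_correct, (proj2 (Hd u v Huv)).
  - apply continuity_2d_pt_filterlim, Hcu, Huv.
Qed.

Lemma ex_derive_along_curve (U : R * R -> Prop) (f : R -> R -> R) (u v : R -> R) (x : R) :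
  open U -> Ck_on 1 U f -> U (u x, v x) -> ex_derive u x -> ex_derive v x ->
  ex_derive (fun t => f (u t) (v t)) x.
Proof.
  intros HU Hf Hx [du Hu] [dv Hv].
  eexists. apply is_derive_Reals, derivable_pt_lim_comp_2d.
  - apply (C1_differentiable U); assumption.
  - apply is_derive_Reals, Hu.
  - apply is_derive_Reals, Hv.
Qed.

(** * The unit normal of the surface and its differentiability along a curve *)

Lemma normG_isotropic (w : vec3) :
  coord1 w = 0 -> normG w = sqrt (coord2 w ^ 2 + coord3 w ^ 2).
Proof.
  intros H. unfold normG, dotG. rewrite H.
  destruct (Req_EM_T 0 0) as [_ | E]; [| now contradiction E].
  f_equal. rewrite Rabs_pos_eq; nra.
Qed.

(** If both components vanished, then [q1 * p - p1 * q = 0]; independence would force [p1 = q1 = 0],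
    against admissibility. Hence the normalization in [param_normal] never divides by zero. *)
Lemma crossG_nonzero (p q : vec3) :
  linearly_independent p q -> coord1 p <> 0 \/ coord1 q <> 0 ->
  0 < coord2 (crossG p q) ^ 2 + coord3 (crossG p q) ^ 2.
Proof.
  destruct p as [[p1 p2] p3], q as [[q1 q2] q3].
  unfold linearly_independent, crossG, coord1, coord2, coord3; cbn [fst snd]; intros Hli Hadm.
  destruct (Req_dec (p3 * q1 - p1 * q3) 0) as [E2 | E2];
    [| apply Rplus_lt_le_0_compat; [now apply pow2_gt_0 | apply pow2_ge_0]].
  destruct (Req_dec (p1 * q2 - p2 * q1) 0) as [E3 | E3];
    [| apply Rplus_le_lt_0_compat; [apply pow2_ge_0 | now apply pow2_gt_0]].
  exfalso. destruct (Hli q1 (- p1)) as [H1 H2].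
  - unfold plus, scal, zero; simpl. unfold prod_plus, prod_scal, prod_zero; simpl.
    unfold plus, scal, zero; simpl. unfold prod_plus, prod_scal, prod_zero; simpl.
    unfold plus, scal, zero, mult; simpl. unfold mult; simpl.
    repeat f_equal; lra.
  - destruct Hadm; lra.
Qed.

(** The chart coordinates of the curve are [psi] composed with [beta], a priori only continuous. The
    components of the Galilean cross product are 2x2 minors of the Jacobian of [phi]; a nonzero one
    selects two coordinates of [phi] to which the planar inversion applies. *)
Lemma chart_curve_derivable (M : vec3 -> Prop) (U : R * R -> Prop) (W : vec3 -> Prop)
    (phi : R -> R -> vec3) (beta : R -> vec3) (x : R) :
  local_parametrization M U W phi ->
  locally x (fun t => M (beta t)) -> W (beta x) ->
  ex_derive (fun t => coord1 (beta t)) x ->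
  ex_derive (fun t => coord2 (beta t)) x ->
  ex_derive (fun t => coord3 (beta t)) x ->
  exists u v : R -> R,
    ex_derive u x /\ ex_derive v x /\
    locally x (fun t => U (u t, v t) /\ phi (u t) (v t) = beta t).
Proof.
  intros (HU & HW & Hphi & Hli & Hadm & psi & _ & Hpsi & Hcont) HM HWx D1 D2 D3.
  assert (Hbeta : continuous beta x).
  { apply filterlim_locally; intros eps.
    assert (C1 := proj1 (filterlim_locally _ _) (ex_derive_continuous _ _ D1) eps).
    assert (C2 := proj1 (filterlim_locally _ _) (ex_derive_continuous _ _ D2) eps).
    assert (C3 := proj1 (filterlim_locally _ _) (ex_derive_continuous _ _ D3) eps).
    generalize (filter_and _ _ C1 (filter_and _ _ C2 C3)); apply filter_imp.
    intros t (H1 & H2 & H3). exact (conj (conj H1 H2) H3). }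
  assert (HMx : M (beta x)) by exact (locally_singleton _ _ HM).
  assert (HMW : locally x (fun t => M (beta t) /\ W (beta t))).
  { apply filter_and; [exact HM | exact (Hbeta _ (HW _ HWx))]. }
  (* [psi] is continuous only relative to [M]; the composition is continuous because [beta] stays in
     [M] near [x]. *)
  assert (Hpb : continuous (fun t => psi (beta t)) x).
  { intros P HP. generalize (filter_and _ _ HM (Hbeta _ (Hcont _ HMx HWx P HP))).
    unfold filtermap; apply filter_imp. intros t [H1 H2]. exact (H2 H1). }
  pose (u := fun t => fst (psi (beta t))). pose (v := fun t => snd (psi (beta t))).
  assert (Hloc : locally x (fun t => U (u t, v t) /\ phi (u t) (v t) = beta t)).
  { revert HMW; apply filter_imp. intros t [H1 H2]. unfold u, v.
    rewrite <- surjective_pairing. exact (Hpsi _ H1 H2). }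
  assert (Hu : continuous u x).
  { apply (continuous_comp (fun t => psi (beta t)) fst); [exact Hpb | apply continuous_fst]. }
  assert (Hv : continuous v x).
  { apply (continuous_comp (fun t => psi (beta t)) snd); [exact Hpb | apply continuous_snd]. }
  destruct (locally_singleton _ _ Hloc) as [Ux _].
  assert (Hw := crossG_nonzero _ _ (Hli _ _ Ux) (Hadm _ _ Ux)).
  destruct (Hphi 1%nat) as (K1 & K2 & K3).
  assert (E : forall c : vec3 -> R, ex_derive (fun t => c (beta t)) x ->
            is_derive (fun t => c (phi (u t) (v t))) x (Derive (fun t => c (beta t)) x)).
  { intros c Hc. apply is_derive_ext_loc with (fun t => c (beta t)).
    - revert Hloc; apply filter_imp. intros t [_ Ht]. now rewrite Ht.
    - now apply Derive_correct. }
  exists u, v.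
  cut (ex_derive u x /\ ex_derive v x); [tauto |].
  (* The third component is the minor of coordinates 1 and 2; if it vanishes, the second component,
     the minor of coordinates 3 and 1, does not. *)
  destruct (Req_dec (coord3 (crossG (phi_u phi (u x) (v x)) (phi_v phi (u x) (v x)))) 0)
    as [Z3 | Z3].
  - assert (Z2 : coord2 (crossG (phi_u phi (u x) (v x)) (phi_v phi (u x) (v x))) <> 0).
    { intros Z2. rewrite Z2, Z3 in Hw. lra. }
    eapply (inverse_curve_derivable (fun u v => coord3 (phi u v)) (fun u v => coord1 (phi u v))
              u v x);
      [exact (C1_differentiable U _ _ _ HU K3 Ux)
      | exact (C1_differentiable U _ _ _ HU K1 Ux) | | assumption | assumption | exact (E _ D3) | exact (E _ D1) ].
    intros F; apply Z2. unfold crossG, coord2, phi_u, phi_v, derive3; simpl.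
    rewrite <- F; unfold partial_u, partial_v, coord1, coord3; simpl; ring.
  - eapply (inverse_curve_derivable (fun u v => coord1 (phi u v)) (fun u v => coord2 (phi u v))
              u v x);
      [exact (C1_differentiable U _ _ _ HU K1 Ux)
      | exact (C1_differentiable U _ _ _ HU K2 Ux) | | assumption | assumption | exact (E _ D1) | exact (E _ D2) ].
    intros F; apply Z3. unfold crossG, coord3, phi_u, phi_v, derive3; simpl.
    rewrite <- F; unfold partial_u, partial_v, coord1, coord2; simpl; ring.
Qed.

(** Near [x] the normal is [s * w / |w|] with a constant sign [s] and [w] the cross product of the
    chart partials along the curve; [w] does not vanish at [x] and is differentiable there because
    the chart coordinates of the curve are. *)
Lemma unit_normal_along_curve (M : oriented_surface) (beta : R -> vec3) (x : R) :
  locally x (fun t => carrier M (beta t)) ->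
  ex_derive (fun t => coord1 (beta t)) x ->
  ex_derive (fun t => coord2 (beta t)) x ->
  ex_derive (fun t => coord3 (beta t)) x ->
  coord1 (darboux_n M beta x) = 0 /\
  coord2 (darboux_n M beta x) ^ 2 + coord3 (darboux_n M beta x) ^ 2 = 1 /\
  ex_derive (fun t => coord2 (darboux_n M beta t)) x /\
  ex_derive (fun t => coord3 (darboux_n M beta t)) x.
Proof.
  intros HM D1 D2 D3.
  destruct (surface_charts M _ (locally_singleton _ _ HM))
    as (U & W & phi & s & Hchart & HWx & Hs & Hn).
  destruct (chart_curve_derivable _ _ _ _ _ _ Hchart HM HWx D1 D2 D3)
    as (u & v & Hu & Hv & Hloc).
  destruct Hchart as (HU & _ & Hphi & Hli & Hadm & _).
  (* Class C^2 of the chart makes its first partials C^1, as the chain rule for [w] requires. *)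
  destruct (Hphi 2%nat) as ((_ & _ & K1u & K1v) & (_ & _ & K2u & K2v) & (_ & _ & K3u & K3v)).
  pose (w := fun t => crossG (phi_u phi (u t) (v t)) (phi_v phi (u t) (v t))).
  pose (w2 := fun t => coord2 (w t)). pose (w3 := fun t => coord3 (w t)).
  destruct (locally_singleton _ _ Hloc) as [Ux _].
  assert (Hpos : 0 < w2 x ^ 2 + w3 x ^ 2)
    by exact (crossG_nonzero _ _ (Hli _ _ Ux) (Hadm _ _ Ux)).
  assert (Hn' : forall t, U (u t, v t) -> phi (u t) (v t) = beta t ->
     coord1 (darboux_n M beta t) = 0 /\
     coord2 (darboux_n M beta t) = s * (/ sqrt (w2 t ^ 2 + w3 t ^ 2) * w2 t) /\
     coord3 (darboux_n M beta t) = s * (/ sqrt (w2 t ^ 2 + w3 t ^ 2) * w3 t)).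
  { intros t Ht Et. unfold darboux_n. rewrite <- Et, (Hn _ _ Ht).
    unfold param_normal. fold (w t). rewrite normG_isotropic by reflexivity.
    split; [| split; reflexivity].
    change (s * (/ sqrt (w2 t ^ 2 + w3 t ^ 2) * 0) = 0). ring. }
  assert (A : forall f, Ck_on 1 U f -> ex_derive (fun t => f (u t) (v t)) x).
  { intros f Hf. now apply (ex_derive_along_curve U). }
  assert (dw2 : ex_derive w2 x).
  { apply (ex_derive_minus (V := R_NormedModule)); apply (ex_derive_mult (fun t => _) (fun t => _));
    [exact (A _ K3u) | exact (A _ K1v) | exact (A _ K1u) | exact (A _ K3v)]. }
  assert (dw3 : ex_derive w3 x).
  { apply (ex_derive_minus (V := R_NormedModule)); apply (ex_derive_mult (fun t => _) (fun t => _));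
    [exact (A _ K1u) | exact (A _ K2v) | exact (A _ K2u) | exact (A _ K1v)]. }
  assert (Hsqrt : sqrt (w2 x ^ 2 + w3 x ^ 2) <> 0)
    by (apply Rgt_not_eq, sqrt_lt_R0, Hpos).
  destruct (locally_singleton _ _ Hloc) as [_ Ex].
  destruct (Hn' x Ux Ex) as (N1 & N2 & N3).
  split; [exact N1 | split; [| split]].
  - rewrite N2, N3.
    assert (Hq := pow2_sqrt _ (Rlt_le _ _ Hpos)).
    replace ((s * (/ sqrt (w2 x ^ 2 + w3 x ^ 2) * w2 x)) ^ 2 +
             (s * (/ sqrt (w2 x ^ 2 + w3 x ^ 2) * w3 x)) ^ 2)
      with (s ^ 2 * ((w2 x ^ 2 + w3 x ^ 2) / sqrt (w2 x ^ 2 + w3 x ^ 2) ^ 2))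
      by (field; exact Hsqrt).
    rewrite Hq. destruct Hs as [-> | ->]; field; lra.
  - apply ex_derive_ext_loc with (fun t => s * (/ sqrt (w2 t ^ 2 + w3 t ^ 2) * w2 t)).
    + revert Hloc; apply filter_imp. intros t [H1 H2]. symmetry; apply (Hn' t H1 H2).
    + auto_derive. repeat split; auto; lra.
  - apply ex_derive_ext_loc with (fun t => s * (/ sqrt (w2 t ^ 2 + w3 t ^ 2) * w3 t)).
    + revert Hloc; apply filter_imp. intros t [H1 H2]. symmetry; apply (Hn' t H1 H2).
    + auto_derive. repeat split; auto; lra.
Qed.

(** * Open intervals with possibly infinite endpoints *)

Lemma Rbar_interval_locally (a b : Rbar) (P : R -> Prop) (x : R) :
  (forall t, Rbar_interval a b t -> P t) -> Rbar_interval a b x -> locally x P.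
Proof.
  intros HP [H1 H2]. apply (locally_interval P x a b H1 H2).
  intros t Ha Hb; apply HP; now split.
Qed.

Lemma Rbar_interval_inhabited (a b : Rbar) :
  Rbar_lt a b -> exists x, Rbar_interval a b x.
Proof.
  unfold Rbar_interval; destruct a as [a | |], b as [b | |]; simpl; intros H;
    try contradiction.
  - exists ((a + b) / 2); split; lra.
  - exists (a + 1); split; [lra | exact I].
  - exists (b - 1); split; [exact I | lra].
  - exists 0; split; exact I.
Qed.

Lemma Rbar_interval_constant (a b : Rbar) (f : R -> R) :
  (forall x, Rbar_interval a b x -> is_derive f x 0) ->
  forall x y, Rbar_interval a b x -> Rbar_interval a b y -> f x = f y.
Proof.
  intros Hf.
  assert (Hlt : forall x y, Rbar_interval a b x -> Rbar_interval a b y -> x < y -> f x = f y).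
  { intros x y [Hx _] [_ Hy] Hxy. apply (eq_is_derive f); [| exact Hxy].
    intros t [H1 H2]. apply Hf. split.
    - apply Rbar_lt_le_trans with x; auto.
    - apply Rbar_le_lt_trans with y; auto. }
  intros x y Hx Hy. destruct (Rtotal_order x y) as [H | [-> | H]]; auto.
  symmetry; auto.
Qed.

(** * The quotient of torsion by curvature and its derivative *)

(** With [N = kn kg' - kg kn'] and [s^2 = kg^2 + kn^2], the derivative of [N / s^3] is
    [(N' s^2 - 3 N (kg kg' + kn kn')) / s^5], where [N' = kn kg'' - kg kn'']. The division by [s^2]
    and then by [s] mirrors torsion over curvature. *)
Lemma helix_ratio_derive (kg kn : R -> R) (x : R) :
  ex_derive kg x -> ex_derive kn x ->
  ex_derive (Derive kg) x -> ex_derive (Derive kn) x ->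
  0 < kg x ^ 2 + kn x ^ 2 ->
  is_derive (fun t => (kn t * Derive kg t - kg t * Derive kn t)
                      / sqrt (kg t ^ 2 + kn t ^ 2) ^ 2 / sqrt (kg t ^ 2 + kn t ^ 2)) x
    ((Derive_n kg 2 x * kn x ^ 3
      + Derive_n kg 2 x * kn x * kg x ^ 2
      - kn x ^ 2 * kg x * Derive_n kn 2 x
      - 3 * kn x ^ 2 * Derive kg x * Derive kn x
      - 3 * kn x * kg x * Derive kg x ^ 2
      + 3 * kn x * kg x * Derive kn x ^ 2
      - kg x ^ 3 * Derive_n kn 2 x
      + 3 * kg x ^ 2 * Derive kg x * Derive kn x) / sqrt (kg x ^ 2 + kn x ^ 2) ^ 5).
Proof.
  intros Dg Dn Dg' Dn' Hpos.
  change (Derive_n kg 2 x) with (Derive (Derive kg) x).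
  change (Derive_n kn 2 x) with (Derive (Derive kn) x).
  assert (Hs : 0 < sqrt (kg x ^ 2 + kn x ^ 2)) by (apply sqrt_lt_R0, Hpos).
  assert (Hq := pow2_sqrt _ (Rlt_le _ _ Hpos)).
  pose (s := fun t => sqrt (kg t ^ 2 + kn t ^ 2)).
  assert (Ds : is_derive s x
            ((kg x * Derive kg x + kn x * Derive kn x) / sqrt (kg x ^ 2 + kn x ^ 2))).
  { replace ((kg x * Derive kg x + kn x * Derive kn x) / sqrt (kg x ^ 2 + kn x ^ 2))
      with ((2 * kg x * Derive kg x + 2 * kn x * Derive kn x)
            / (2 * sqrt (kg x ^ 2 + kn x ^ 2))) by (field; lra).
    apply (is_derive_sqrt (fun t => kg t ^ 2 + kn t ^ 2)); [| exact Hpos].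
    auto_derive; [repeat split; auto |].
    change (Derive (fun x => kg x) x) with (Derive kg x).
    change (Derive (fun x => kn x) x) with (Derive kn x). ring. }
  assert (Hs' := is_derive_unique _ _ _ Ds).
  change (sqrt (kg x ^ 2 + kn x ^ 2)) with (s x) in *.
  apply is_derive_ext with
    (fun t => (kn t * Derive kg t - kg t * Derive kn t) / s t ^ 2 / s t);
    [reflexivity |].
  assert (Ds0 : ex_derive s x) by (eexists; exact Ds).
  assert (Hp : s x ^ 2 <> 0) by (rewrite Hq; lra).
  assert (Hp1 : s x <> 0) by lra.
  (* From here [s] is an opaque function with known derivative, so [auto_derive] does not expand the
     root. *)
  clearbody s.
  auto_derive; [repeat split; auto; try (simpl in Hp; lra) |].
  change (Derive (fun x : R => s x) x) with (Derive s x).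
  change (Derive (fun x : R => kg x) x) with (Derive kg x).
  change (Derive (fun x : R => kn x) x) with (Derive kn x).
  change (Derive (fun x : R => Derive kg x) x) with (Derive (Derive kg) x).
  change (Derive (fun x : R => Derive kn x) x) with (Derive (Derive kn) x).
  rewrite Hs'.
  apply Rminus_diag_uniq.
  (* The computed and claimed derivatives differ by a multiple of [s^2 - (kg^2 + kn^2)], which is
     zero. *)
  match goal with |- ?l = 0 => replace l with
   ((kn x * Derive (Derive kg) x - kg x * Derive (Derive kn) x)
     * (s x ^ 2 - (kg x ^ 2 + kn x ^ 2)) / s x ^ 5) by (field; lra) end.
  rewrite Hq. unfold Rdiv. ring.
Qed.

(** On an interval the ratio is constant exactly when its derivative vanishes, and the denominator
    [s^5] of that derivative is never zero. *)
Lemma helix_iff (a b : Rbar) (kg kn : R -> R) :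
  Rbar_lt a b ->
  (forall x, Rbar_interval a b x ->
     ex_derive kg x /\ ex_derive kn x /\ ex_derive (Derive kg) x /\
     ex_derive (Derive kn) x /\ 0 < kg x ^ 2 + kn x ^ 2) ->
  (exists c, forall x, Rbar_interval a b x ->
     (kn x * Derive kg x - kg x * Derive kn x)
       / sqrt (kg x ^ 2 + kn x ^ 2) ^ 2 / sqrt (kg x ^ 2 + kn x ^ 2) = c) <->
  (forall x, Rbar_interval a b x ->
     Derive_n kg 2 x * kn x ^ 3
     + Derive_n kg 2 x * kn x * kg x ^ 2
     - kn x ^ 2 * kg x * Derive_n kn 2 x
     - 3 * kn x ^ 2 * Derive kg x * Derive kn x
     - 3 * kn x * kg x * Derive kg x ^ 2
     + 3 * kn x * kg x * Derive kn x ^ 2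
     - kg x ^ 3 * Derive_n kn 2 x
     + 3 * kg x ^ 2 * Derive kg x * Derive kn x = 0).
Proof.
  intros Hab H.
  pose (r := fun t => (kn t * Derive kg t - kg t * Derive kn t)
       / sqrt (kg t ^ 2 + kn t ^ 2) ^ 2 / sqrt (kg t ^ 2 + kn t ^ 2)).
  split.
  - intros [c Hc] x Hx. destruct (H x Hx) as (H1 & H2 & H3 & H4 & H5).
    assert (HD := is_derive_unique r _ _ (helix_ratio_derive _ _ _ H1 H2 H3 H4 H5)).
    rewrite (Derive_ext_loc r (fun _ => c) x (Rbar_interval_locally _ _ _ _ Hc Hx)),
      Derive_const in HD.
    assert (Hs : sqrt (kg x ^ 2 + kn x ^ 2) ^ 5 <> 0)
      by (apply pow_nonzero, Rgt_not_eq, sqrt_lt_R0, H5).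
    symmetry in HD. apply Rmult_integral in HD as [HD | HD]; [exact HD |].
    now apply Rinv_neq_0_compat in Hs.
  - intros Hode. destruct (Rbar_interval_inhabited a b Hab) as [x0 Hx0].
    exists (r x0). intros x Hx. apply (Rbar_interval_constant a b r); auto.
    intros t Ht. destruct (H t Ht) as (H1 & H2 & H3 & H4 & H5).
    replace 0 with (0 / sqrt (kg t ^ 2 + kn t ^ 2) ^ 5) by (unfold Rdiv; ring).
    rewrite <- (Hode t Ht) at 1. now apply helix_ratio_derive.
Qed.

(** * Curvature, torsion and Darboux frame of a unit-speed curve in coordinates *)

Lemma dotG_isotropic (v w : vec3) :
  coord1 v = 0 -> coord1 w = 0 ->
  dotG v w = coord2 v * coord2 w + coord3 v * coord3 w.
Proof.
  intros Hv Hw. unfold dotG. rewrite Hv, Hw.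
  destruct (Req_EM_T 0 0) as [_ | E]; [reflexivity | now contradiction E].
Qed.

Section UnitSpeed.

Variables (a b : Rbar) (beta : R -> vec3).
Hypothesis hbeta : unit_speed_curve (Rbar_interval a b) beta.

(** Makes the second derivative of the curve isotropic, so its products with [Q] and [n] fall in the
    Euclidean branch of [dotG]. *)
Lemma unit_speed_coord1 (x : R) :
  Rbar_interval a b x ->
  coord1 (derive3 beta x) = 1 /\
  coord1 (derive3 (derive3 beta) x) = 0 /\
  coord1 (derive3 (derive3 (derive3 beta)) x) = 0.
Proof.
  destruct hbeta as [_ H0].
  assert (H1 : forall t, Rbar_interval a b t -> coord1 (derive3 beta t) = 1).
  { intros t Ht. change (Derive (fun r => coord1 (beta r)) t = 1).
    rewrite (Derive_ext_loc _ _ _ (Rbar_interval_locally _ _ _ _ H0 Ht)).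
    apply Derive_id. }
  assert (H2 : forall t, Rbar_interval a b t -> coord1 (derive3 (derive3 beta) t) = 0).
  { intros t Ht. change (Derive (fun r => coord1 (derive3 beta r)) t = 0).
    rewrite (Derive_ext_loc _ (fun _ => 1) _ (Rbar_interval_locally _ _ _ _ H1 Ht)).
    apply Derive_const. }
  intros Hx. split; [| split]; auto.
  change (Derive (fun r => coord1 (derive3 (derive3 beta) r)) x = 0).
  rewrite (Derive_ext_loc _ (fun _ => 0) _ (Rbar_interval_locally _ _ _ _ H2 Hx)).
  apply Derive_const.
Qed.

Lemma unit_speed_curvature (x : R) :
  Rbar_interval a b x ->
  curvature beta x = sqrt (coord2 (derive3 (derive3 beta) x) ^ 2
                           + coord3 (derive3 (derive3 beta) x) ^ 2).
Proof.
  intros Hx. apply normG_isotropic, (unit_speed_coord1 x Hx).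
Qed.

Lemma unit_speed_torsion (x : R) :
  Rbar_interval a b x ->
  torsion beta x =
    (coord2 (derive3 (derive3 beta) x) * coord3 (derive3 (derive3 (derive3 beta)) x)
     - coord3 (derive3 (derive3 beta) x) * coord2 (derive3 (derive3 (derive3 beta)) x))
    / curvature beta x ^ 2.
Proof.
  intros Hx. destruct (unit_speed_coord1 x Hx) as (E1 & E2 & E3).
  unfold torsion, det3. rewrite E1, E2, E3. f_equal. ring.
Qed.

Variable M : oriented_surface.
Hypothesis hM : forall x, Rbar_interval a b x -> carrier M (beta x).

Lemma darboux_n_regular (x : R) :
  Rbar_interval a b x ->
  coord1 (darboux_n M beta x) = 0 /\
  coord2 (darboux_n M beta x) ^ 2 + coord3 (darboux_n M beta x) ^ 2 = 1 /\
  ex_derive (fun t => coord2 (darboux_n M beta t)) x /\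
  ex_derive (fun t => coord3 (darboux_n M beta t)) x.
Proof.
  destruct hbeta as [(S1 & S2 & S3) _]. intros Hx.
  apply unit_normal_along_curve.
  - exact (Rbar_interval_locally _ _ _ _ hM Hx).
  - exact (S1 1%nat x Hx).
  - exact (S2 1%nat x Hx).
  - exact (S3 1%nat x Hx).
Qed.

(** [Q] is the normal turned by a quarter turn in the isotropic plane. *)
Lemma darboux_Q_coords (x : R) :
  Rbar_interval a b x ->
  darboux_Q M beta x = (0, - coord3 (darboux_n M beta x), coord2 (darboux_n M beta x)).
Proof.
  intros Hx. destruct (unit_speed_coord1 x Hx) as (E1 & _ & _).
  destruct (darboux_n_regular x Hx) as (N1 & _).
  unfold darboux_Q, crossG, darboux_T. rewrite E1, N1. repeat f_equal; ring.
Qed.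

(** Up to sign this is the determinant of [n] and its derivative in the isotropic plane. *)
Lemma geodesic_torsion_coords (x : R) :
  Rbar_interval a b x ->
  geodesic_torsion M beta x =
    Derive (fun t => coord2 (darboux_n M beta t)) x * coord3 (darboux_n M beta x)
    - Derive (fun t => coord3 (darboux_n M beta t)) x * coord2 (darboux_n M beta x).
Proof.
  intros Hx. destruct (darboux_n_regular x Hx) as (N1 & _).
  assert (EQ := Rbar_interval_locally a b _ x darboux_Q_coords Hx).
  assert (Q1 : coord1 (derive3 (darboux_Q M beta) x) = 0).
  { exact (Derive_const 0 x). }
  assert (Q2 : coord2 (derive3 (darboux_Q M beta) x)
               = - Derive (fun t => coord3 (darboux_n M beta t)) x).
  { rewrite <- Derive_opp. apply Derive_ext_loc. revert EQ; apply filter_imp.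
    intros t Et. now rewrite Et. }
  assert (Q3 : coord3 (derive3 (darboux_Q M beta) x)
               = Derive (fun t => coord2 (darboux_n M beta t)) x).
  { apply Derive_ext_loc. revert EQ; apply filter_imp. intros t Et. now rewrite Et. }
  unfold geodesic_torsion. rewrite (dotG_isotropic _ _ Q1 N1), Q2, Q3. ring.
Qed.

(* Differentiating |n| = 1 gives n' . n = 0, and [geodesic_torsion] is the
   component of n' orthogonal to n up to sign. *)
Lemma line_of_curvature_normal_constant :
  line_of_curvature (Rbar_interval a b) M beta ->
  forall x y, Rbar_interval a b x -> Rbar_interval a b y ->
    coord2 (darboux_n M beta x) = coord2 (darboux_n M beta y) /\
    coord3 (darboux_n M beta x) = coord3 (darboux_n M beta y).
Proof.
  intros hline.
  pose (n2 := fun t => coord2 (darboux_n M beta t)).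
  pose (n3 := fun t => coord3 (darboux_n M beta t)).
  assert (Hn : forall t, Rbar_interval a b t -> is_derive n2 t 0 /\ is_derive n3 t 0).
  { intros t Ht. destruct (darboux_n_regular t Ht) as (_ & N & D2 & D3).
    assert (Ht0 := hline t Ht). rewrite (geodesic_torsion_coords t Ht) in Ht0.
    apply Derive_correct in D2, D3.
    fold n2 in D2, N, Ht0. fold n3 in D3, N, Ht0.
    change (n2 t ^ 2 + n3 t ^ 2 = 1) in N.
    change (Derive n2 t * n3 t - Derive n3 t * n2 t = 0) in Ht0.
    assert (Hc : 2 * (n2 t * Derive n2 t + n3 t * Derive n3 t) = 0).
    { transitivity (Derive (fun r => n2 r ^ 2 + n3 r ^ 2) t).
      - symmetry. apply is_derive_unique. auto_derive.
        + repeat split; eexists; eassumption.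
        + change (Derive (fun x => n2 x) t) with (Derive n2 t).
          change (Derive (fun x => n3 x) t) with (Derive n3 t). ring.
      - rewrite <- (Derive_const 1 t). apply Derive_ext_loc.
        apply (Rbar_interval_locally a b); [| exact Ht].
        intros r Hr. apply (darboux_n_regular r Hr). }
    (* [Hc] and [Ht0] form a linear system for the two derivatives whose determinant is
       [-(n2^2 + n3^2) = -1]. *)
    assert (Z2 : Derive n2 t = 0).
    { replace (Derive n2 t) with
        ((n2 t ^ 2 + n3 t ^ 2) * Derive n2 t) by (rewrite N; ring).
      replace ((n2 t ^ 2 + n3 t ^ 2) * Derive n2 t) with
        (n2 t * (n2 t * Derive n2 t + n3 t * Derive n3 t)
         + n3 t * (Derive n2 t * n3 t - Derive n3 t * n2 t)) by ring.
      rewrite Ht0. replace (n2 t * Derive n2 t + n3 t * Derive n3 t) with 0 by lra. ring. }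
    assert (Z3 : Derive n3 t = 0).
    { replace (Derive n3 t) with
        ((n2 t ^ 2 + n3 t ^ 2) * Derive n3 t) by (rewrite N; ring).
      replace ((n2 t ^ 2 + n3 t ^ 2) * Derive n3 t) with
        (n3 t * (n2 t * Derive n2 t + n3 t * Derive n3 t)
         - n2 t * (Derive n2 t * n3 t - Derive n3 t * n2 t)) by ring.
      rewrite Ht0. replace (n2 t * Derive n2 t + n3 t * Derive n3 t) with 0 by lra. ring. }
    change (is_derive n2 t (Derive n2 t)) in D2. change (is_derive n3 t (Derive n3 t)) in D3.
    rewrite Z2 in D2. rewrite Z3 in D3. now split. }
  intros x y Hx Hy.
  split; [apply (Rbar_interval_constant a b n2) | apply (Rbar_interval_constant a b n3)];
    auto; intros t Ht; apply (Hn t Ht).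
Qed.

End UnitSpeed.

(** * Reduction to a fixed rotated frame and conclusion *)

Theorem corollary4p14 (a b : Rbar) (M : oriented_surface) (beta : R -> vec3)
    (hab : Rbar_lt a b)
    (hbeta : unit_speed_curve (Rbar_interval a b) beta)
    (hM : forall x, Rbar_interval a b x -> carrier M (beta x))
    (hkappa : forall x, Rbar_interval a b x -> 0 < curvature beta x)
    (hline : line_of_curvature (Rbar_interval a b) M beta) :
  let kg := geodesic_curvature M beta in
  let kn := normal_curvature M beta in
  generalized_helix (Rbar_interval a b) beta <->
  (forall x, Rbar_interval a b x ->
     Derive_n kg 2 x * kn x ^ 3
     + Derive_n kg 2 x * kn x * kg x ^ 2
     - kn x ^ 2 * kg x * Derive_n kn 2 x
     - 3 * kn x ^ 2 * Derive kg x * Derive kn x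
     - 3 * kn x * kg x * Derive kg x ^ 2
     + 3 * kn x * kg x * Derive kn x ^ 2
     - kg x ^ 3 * Derive_n kn 2 x
     + 3 * kg x ^ 2 * Derive kg x * Derive kn x = 0).
Proof.
  intros kg kn.
  destruct (Rbar_interval_inhabited a b hab) as [x0 Hx0].
  (* The normal is constant, so its value at [x0] serves on the whole interval. *)
  pose (A := coord2 (darboux_n M beta x0)). pose (B := coord3 (darboux_n M beta x0)).
  assert (HAB : A ^ 2 + B ^ 2 = 1)
    by apply (darboux_n_regular a b beta hbeta M hM x0 Hx0).
  pose (y2 := fun t => coord2 (derive3 (derive3 beta) t)).
  pose (z2 := fun t => coord3 (derive3 (derive3 beta) t)).
  assert (Hk : forall t, Rbar_interval a b t ->
            kg t = A * z2 t - B * y2 t /\ kn t = A * y2 t + B * z2 t).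
  { intros t Ht.
    destruct (unit_speed_coord1 a b beta hbeta t Ht) as (_ & E2 & _).
    destruct (darboux_n_regular a b beta hbeta M hM t Ht) as (N1 & _).
    destruct (line_of_curvature_normal_constant a b beta hbeta M hM hline t x0 Ht Hx0)
      as [EA EB]. fold A in EA. fold B in EB.
    split.
    - unfold kg, geodesic_curvature, darboux_T.
      rewrite (darboux_Q_coords a b beta hbeta M hM t Ht), dotG_isotropic;
        [| exact E2 | reflexivity].
      fold (y2 t) (z2 t). rewrite EA, EB.
      change (y2 t * - B + z2 t * A = A * z2 t - B * y2 t). ring.
    - unfold kn, normal_curvature, darboux_T.
      rewrite dotG_isotropic; [| exact E2 | exact N1].
      fold (y2 t) (z2 t). rewrite EA, EB. ring. }
  destruct (proj1 hbeta) as (_ & S2 & S3).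
  (* [y2] is already a second derivative, so orders 3 and 4 of smoothness are the ones invoked. *)
  assert (Dy : forall t, Rbar_interval a b t -> ex_derive y2 t /\ ex_derive (Derive y2) t)
    by (intros t Ht; split; [exact (S2 3%nat t Ht) | exact (S2 4%nat t Ht)]).
  assert (Dz : forall t, Rbar_interval a b t -> ex_derive z2 t /\ ex_derive (Derive z2) t)
    by (intros t Ht; split; [exact (S3 3%nat t Ht) | exact (S3 4%nat t Ht)]).
  assert (Hk' : forall t, Rbar_interval a b t ->
            is_derive kg t (A * Derive z2 t - B * Derive y2 t) /\
            is_derive kn t (A * Derive y2 t + B * Derive z2 t)).
  { intros t Ht. destruct (Dy t Ht) as [Hy _], (Dz t Ht) as [Hz _]. split.
    - apply is_derive_ext_loc with (fun r => A * z2 r - B * y2 r).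
      + apply (Rbar_interval_locally a b); [| exact Ht]. intros r Hr. symmetry; apply (Hk r Hr).
      + auto_derive; [repeat split; auto |].
        change (Derive (fun x => y2 x) t) with (Derive y2 t).
        change (Derive (fun x => z2 x) t) with (Derive z2 t). ring.
    - apply is_derive_ext_loc with (fun r => A * y2 r + B * z2 r).
      + apply (Rbar_interval_locally a b); [| exact Ht]. intros r Hr. symmetry; apply (Hk r Hr).
      + auto_derive; [repeat split; auto |].
        change (Derive (fun x => y2 x) t) with (Derive y2 t).
        change (Derive (fun x => z2 x) t) with (Derive z2 t). ring. }
  assert (HN : forall t, Rbar_interval a b t -> kg t ^ 2 + kn t ^ 2 = y2 t ^ 2 + z2 t ^ 2).
  { intros t Ht. destruct (Hk t Ht) as [-> ->].
    transitivity ((A ^ 2 + B ^ 2) * (y2 t ^ 2 + z2 t ^ 2)); [ring | rewrite HAB; ring]. }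
  (* A rotation preserves both the norm of [(y2, z2)] and its determinant with the derivative, which
     is the numerator of the torsion. *)
  assert (HR : forall t, Rbar_interval a b t ->
     torsion beta t / curvature beta t =
     (kn t * Derive kg t - kg t * Derive kn t)
       / sqrt (kg t ^ 2 + kn t ^ 2) ^ 2 / sqrt (kg t ^ 2 + kn t ^ 2)).
  { intros t Ht. rewrite (unit_speed_torsion a b beta hbeta t Ht).
    rewrite (unit_speed_curvature a b beta hbeta t Ht), (HN t Ht).
    destruct (Hk t Ht) as [Eg En], (Hk' t Ht) as [Eg' En'].
    rewrite (is_derive_unique _ _ _ Eg'), (is_derive_unique _ _ _ En'), Eg, En.
    do 2 (unfold Rdiv; apply Rmult_eq_compat_r).
    transitivity ((A ^ 2 + B ^ 2) * (y2 t * Derive z2 t - z2 t * Derive y2 t));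
      [rewrite HAB, Rmult_1_l; reflexivity | ring]. }
  rewrite <- (helix_iff a b kg kn hab).
  - unfold generalized_helix. split; intros [c Hc]; exists c; intros t Ht.
    + rewrite <- (HR t Ht). auto.
    + rewrite (HR t Ht). auto.
  - intros t Ht. destruct (Hk' t Ht) as [Eg En], (Dy t Ht) as [_ Hy], (Dz t Ht) as [_ Hz].
    repeat split.
    + eexists; exact Eg.
    + eexists; exact En.
    (* The formula for the derivative of [kg] holds on a neighbourhood, so it can be differentiated
       again. *)
    + apply ex_derive_ext_loc with (fun r => A * Derive z2 r - B * Derive y2 r).
      * apply (Rbar_interval_locally a b); [| exact Ht].
        intros r Hr. symmetry; apply is_derive_unique, (Hk' r Hr).
      * auto_derive. repeat split; auto.
    + apply ex_derive_ext_loc with (fun r => A * Derive y2 r + B * Derive z2 r).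
      * apply (Rbar_interval_locally a b); [| exact Ht].
        intros r Hr. symmetry; apply is_derive_unique, (Hk' r Hr).
      * auto_derive. repeat split; auto.
    + rewrite (HN t Ht). assert (Hc := hkappa t Ht).
      rewrite (unit_speed_curvature a b beta hbeta t Ht) in Hc.
      apply sqrt_lt_0_alt. rewrite sqrt_0. exact Hc.
Qed.
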